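(* Let $S=\mathbb{C}[x_0,\ldots,x_n]$ and $T=\mathbb{C}[X_0,\ldots,X_n]$. Let $\mathcal{M}=\{M_j\}_{j\in J}$ be a finite nonempty collection of monomials $M_j=x_0^{a_{0,j}}x_1^{a_{1,j}}\cdots x_n^{a_{n,j}}\in S$ with $1\le a_{0,j}\le a_{i,j}$ for every $i,j$. For $\{j_1,\ldots,j_k\}\subseteq J$ let $M_{j_1,\ldots,j_k}$ denote the greatest common divisor of $M_{j_1},\ldots,M_{j_k}$. Let $A=T/I$ be the finite $\mathbb{C}$-algebra with $I=(X_0)+\bigcap_{j\in J}M_j^{\perp}$. Then $$\dim_{\mathbb{C}}A=\sum_{\emptyset\ne\{j_1,\ldots,j_k\}\subseteq J}(-1)^{k+1}\,\mathrm{rk}_{\mathbb{C}}\,M_{j_1,\ldots,j_k},$$ where the sum is over all nonempty subsets of $J$ and $k$ denotes the cardinality of the subset.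
   Context: Here $n$ is a nonnegative integer. The ring $T=\mathbb{C}[X_0,\ldots,X_n]$ acts on $S=\mathbb{C}[x_0,\ldots,x_n]$ by differentiation, with $X_i$ acting as $\partial/\partial x_i$. For a homogeneous polynomial $F\in S$, its apolar ideal is $F^{\perp}=\{G\in T : G(F)=0\}\subset T$. For a homogeneous polynomial $F$ of degree $d$, $\mathrm{rk}_{\mathbb{C}}\,F$ is its complex Waring rank, i.e. the minimal integer $r$ such that $F=\sum_{j=1}^r\lambda_jL_j^{d}$ for some linear forms $L_1,\ldots,L_r\in S$ and $\lambda_j\in\mathbb{C}$. *)

(* Defs.v *)
From HB Require Import structures.
From mathcomp Require Import all_boot all_order all_algebra.
From mathcomp Require Import boolp reals complex mpoly ssrcomplements.

Set Implicit Arguments.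
Unset Strict Implicit.
Unset Printing Implicit Defensive.

Import Order.TTheory GRing.Theory Num.Theory.

Local Open Scope ring_scope.
Local Open Scope quotient_scope.

(* The quotient of a module by a submodule.  [ring_quotient] only provides the
   additive group; the scaling is added here. *)
Section QuotientModule.
Variables (K : nzRingType) (V : lmodType K) (I : submodClosed V).

(* [submodClosed] does not inherit from [zmodClosed]. *)
Definition submod_pred : {pred V} := I.

Fact submod_pred_zmod : zmod_closed submod_pred.
Proof.
split=> [|u v uI vI]; first exact: (rpred0 I).
by rewrite -[- v]scaleN1r; apply: (@rpredD _ I) => //; apply: rpredZ.
Qed.

HB.instance Definition _ := GRing.isZmodClosed.Build V submod_pred
  submod_pred_zmod.

Definition quot_mod : Type := Quotient.quot submod_pred.
HB.instance Definition _ := GRing.Zmodule.on quot_mod.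

Definition quot_scale (a : K) (u : quot_mod) : quot_mod :=
  \pi_(Quotient.quot submod_pred) (a *: repr u).

Lemma quot_scale_pi (a : K) (v : V) :
  quot_scale a (\pi_(Quotient.quot submod_pred) v) = \pi_(Quotient.quot submod_pred) (a *: v).
Proof.
apply/eqP; rewrite -Quotient.idealrBE -scalerBr; apply: (@rpredZ _ _ I).
by rewrite -[_ \in _]/(_ \in submod_pred) Quotient.idealrBE reprK.
Qed.

Lemma quot_modD (u v : V) : (\pi_(Quotient.quot submod_pred) u : quot_mod)
  + \pi_(Quotient.quot submod_pred) v = \pi_(Quotient.quot submod_pred) (u + v).
Proof. by rewrite [RHS]raddfD. Qed.

Lemma quot_modP (u : quot_mod) : exists v, u = \pi_(Quotient.quot submod_pred) v.
Proof. by exists (repr u); rewrite reprK. Qed.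

Lemma quot_scaleA a b u : quot_scale a (quot_scale b u) = quot_scale (a * b) u.
Proof. by have [v ->] := quot_modP u; rewrite !quot_scale_pi scalerA. Qed.

Lemma quot_scale1 : left_id 1 quot_scale.
Proof. by move=> u; have [v ->] := quot_modP u; rewrite quot_scale_pi scale1r. Qed.

Lemma quot_scaleDr : right_distributive quot_scale +%R.
Proof.
move=> a u v; have [x ->] := quot_modP u; have [y ->] := quot_modP v.
by rewrite quot_modD !quot_scale_pi quot_modD scalerDr.
Qed.

Lemma quot_scaleDl u : {morph quot_scale^~ u : a b / a + b}.
Proof.
move=> a b; have [x ->] := quot_modP u.
by rewrite !quot_scale_pi quot_modD scalerDl.
Qed.

HB.instance Definition _ := GRing.Zmodule_isLmodule.Build K quot_mod
  quot_scaleA quot_scale1 quot_scaleDr quot_scaleDl.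

End QuotientModule.

(* [Vector.axiom d V] is a linear isomorphism of [V] with ['rV_d]. *)
Definition has_dim (K : nzRingType) (V : lmodType K) (d : nat) : Prop :=
  inhabited (Vector.axiom d V).

Section Apolarity.
Variables (K : fieldType) (n : nat).
Implicit Types (F G H : {mpoly K[n]}).

(* G(F), where the variable 'X_i of G acts as the i-th partial derivative. *)
Definition diff_act G F : {mpoly K[n]} :=
  \sum_(m <- msupp G) G@_m *: F^`M[m].

Definition apolar_ideal F : {pred {mpoly K[n]}} := fun G => diff_act G F == 0.

Lemma diff_actwE k G F : (msize G <= k)%N ->
  diff_act G F = \sum_(m : 'X_{1..n < k}) G@_m *: F^`M[m].
Proof.
move=> le_k; rewrite /diff_act.
pose I : subFinType _ := 'X_{1..n < k}.
rewrite (big_mksub I) //=; first last.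
- by move=> m /msize_mdeg_lt /leq_trans; apply.
- by rewrite msupp_uniq.
by rewrite big_rmcond //= => m /memN_msupp_eq0 ->; rewrite scale0r.
Qed.

Lemma diff_actP F a G H :
  diff_act (a *: G + H) F = a *: diff_act G F + diff_act H F.
Proof.
pose k := maxn (msize (a *: G + H)) (maxn (msize G) (msize H)).
rewrite !(@diff_actwE k) ?leq_max ?leqnn ?orbT //.
rewrite scaler_sumr -big_split /=; apply: eq_bigr => m _.
by rewrite mcoeffD mcoeffZ scalerDl scalerA.
Qed.

Lemma diff_act0 F : diff_act 0 F = 0.
Proof. by rewrite /diff_act msupp0 big_nil. Qed.

Lemma apolar0 F : 0 \in apolar_ideal F.
Proof. by rewrite unfold_in diff_act0. Qed.

Lemma apolarP F a G H : G \in apolar_ideal F -> H \in apolar_ideal F ->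
  a *: G + H \in apolar_ideal F.
Proof.
rewrite !unfold_in diff_actP => /eqP -> /eqP ->.
by rewrite scaler0 addr0.
Qed.

Lemma diff_actX m F : diff_act 'X_[m] F = F^`M[m].
Proof. by rewrite /diff_act msuppX big_seq1 mcoeffX eqxx scale1r. Qed.

Lemma diff_actMX G m F : diff_act ('X_[m] * G) F = diff_act G F^`M[m].
Proof.
rewrite {1}(mpolyE G) /(diff_act G); elim: (msupp G) => [|m' r IH].
  by rewrite !big_nil mulr0 diff_act0.
rewrite !big_cons mulrDr -scalerAr diff_actP IH.
by rewrite -mpolyXD diff_actX mderivmDm.
Qed.

Lemma diff_act_rP G a F1 F2 :
  diff_act G (a *: F1 + F2) = a *: diff_act G F1 + diff_act G F2.
Proof.
rewrite /diff_act scaler_sumr -big_split /=; apply: eq_bigr => m _.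
by rewrite mderivmD mderivmZ scalerDr !scalerA mulrC.
Qed.

Lemma diff_act_r0 G : diff_act G 0 = 0.
Proof. by rewrite /diff_act big1 // => m _; rewrite raddf0 scaler0. Qed.

Lemma diff_actM G H F : diff_act (G * H) F = diff_act H (diff_act G F).
Proof.
rewrite {1}(mpolyE G) /(diff_act G) mulr_suml.
elim: (msupp G) => [|m r IH].
  by rewrite !big_nil diff_act0 diff_act_r0.
by rewrite !big_cons -scalerAl diff_actP IH diff_actMX diff_act_rP.
Qed.

Lemma apolar_idealM F G H : G \in apolar_ideal F -> G * H \in apolar_ideal F.
Proof.
by rewrite !unfold_in diff_actM => /eqP ->; rewrite diff_act_r0.
Qed.

End Apolarity.

Section ApolarSum.
Variables (K : fieldType) (n : nat) (J : finType) (M : J -> 'X_{1..n.+1}).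

(* The ideal (X_0) + \bigcap_j M_j^\perp. *)
Definition X0_plus_apolar : {pred {mpoly K[n.+1]}} := fun G =>
  `[< exists P Q : {mpoly K[n.+1]},
        G = 'X_ord0 * P + Q /\ forall j, Q \in apolar_ideal 'X_[M j] >].

Fact X0_plus_apolar_submod : submod_closed X0_plus_apolar.
Proof.
split=> [|a G H /asboolP[P1 [Q1 [-> apQ1]]] /asboolP[P2 [Q2 [-> apQ2]]]].
  by apply/asboolP; exists 0, 0; rewrite mulr0 addr0; split=> // j; apply: apolar0.
apply/asboolP; exists (a *: P1 + P2), (a *: Q1 + Q2); split=> [|j].
  by rewrite mulrDr -scalerAr scalerDr addrACA.
exact: apolarP.
Qed.

HB.instance Definition _ := GRing.isSubmodClosed.Build K {mpoly K[n.+1]}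
  X0_plus_apolar X0_plus_apolar_submod.

Lemma X0_plus_apolarM G H : G \in X0_plus_apolar -> G * H \in X0_plus_apolar.
Proof.
move=> /asboolP[P [Q [-> apQ]]]; apply/asboolP; exists (P * H), (Q * H).
by split=> [|j]; rewrite ?mulrDl ?mulrA // apolar_idealM.
Qed.

End ApolarSum.

(* The greatest common divisor of the monomials M_j, j \in B, for B nonempty:
   the exponent of x_i is the minimum over j \in B of M_j i.  The seed of the
   iterated minimum is irrelevant as it bounds every term. *)
Definition mgcd (n : nat) (J : finType) (M : J -> 'X_{1..n}) (B : {set J}) :
    'X_{1..n} :=
  [multinom \big[minn / \max_(j in B) M j i]_(j in B) M j i | i < n].

Lemma mgcd_le (n : nat) (J : finType) (M : J -> 'X_{1..n}) (B : {set J}) j :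
  j \in B -> (mgcd M B <= M j)%MM.
Proof.
move=> jB; apply/mnm_lepP => i; rewrite mnmE -minEnat -leEnat.
exact: (bigmin_le_cond _ (fun j => M j i) jB).
Qed.

Lemma le_mgcd (n : nat) (J : finType) (M : J -> 'X_{1..n}) (B : {set J}) m :
  B != set0 -> (forall j, j \in B -> (m <= M j)%MM) -> (m <= mgcd M B)%MM.
Proof.
move=> /set0Pn[j0 j0B] le_m; apply/mnm_lepP => i; rewrite mnmE.
apply: (@big_ind _ (fun k => (m i <= k)%N)).
- apply: leq_trans (@leq_bigmax_cond _ (mem B) (fun j => M j i) j0 j0B).
  by have /mnm_lepP := le_m _ j0B.
- by move=> a b ha hb; rewrite leq_min ha.
- by move=> j jB; have /mnm_lepP := le_m _ jB.
Qed.

(* [mgcd] is a greatest common divisor in the whole polynomial ring, not only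
   among monomials: see [mgcd_dvd] and [dvd_mgcd]. *)
Section MgcdPoly.
Variables (K : fieldType) (n : nat).
Implicit Types (P Q : {mpoly K[n]}).

Lemma mcoeffM_mlast P Q : P != 0 -> Q != 0 ->
  (P * Q)@_(mlast P + mlast Q) = P@_(mlast P) * Q@_(mlast Q).
Proof.
move=> nzP nzQ; rewrite mpolyME (bigD1_seq (mlast P, mlast Q)) /=; first last.
- by rewrite allpairs_uniq => // -[? ?] [].
- by rewrite allpairs_f // !mlast_supp.
rewrite mcoeffD mcoeffZ mcoeffX eqxx mulr1.
rewrite big_seq_cond raddf_sum /= big1 ?addr0 //.
case=> m1 m2; rewrite in_allpairs //= -andbA; case/and3P.
move=> m1P m2Q ne; rewrite mcoeffZ mcoeffX.
move/mlast_lemc: m1P; move/mlast_lemc: m2Q.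
rewrite le_eqVlt => /predU1P[m2E|lt2 le1]; last first.
  by rewrite (gt_eqF (lemc_lt_add le1 lt2)) mulr0.
move: ne; rewrite -m2E xpair_eqE eqxx andbT => ne.
by rewrite le_eqVlt eq_sym (negbTE ne) /= eqm_add2r => /gt_eqF ->; rewrite mulr0.
Qed.

Lemma mdvd_mpolyX P Q m : 'X_[m] = P * Q ->
  exists (c : K) (m' : 'X_{1..n}), c != 0 /\ P = c *: 'X_[m'].
Proof.
move=> E; have : P * Q != 0 by rewrite -E -msupp_eq0 msuppX.
rewrite mulf_eq0 negb_or => /andP[nzP nzQ].
have Elead : (mlead P + mlead Q)%MM = m by rewrite -mleadM // -E mleadXm.
have Elast : (mlast P + mlast Q)%MM = m.
  have : (P * Q)@_(mlast P + mlast Q) != 0.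
    by rewrite mcoeffM_mlast // mulf_neq0 // -mcoeff_msupp mlast_supp.
  by rewrite -E mcoeffX; case: (eqVneq m) => [->|_] //; rewrite mulr0n eqxx.
have leQ : (mlast Q <= mlead Q)%O by apply: mlast_lemc; apply: mlead_supp.
have Pl : mlead P = mlast P.
  apply: contra_eq (etrans Elead (esym Elast)) => ne.
  rewrite gt_eqF //; apply: ltmc_le_add leQ.
  by rewrite lt_neqAle eq_sym ne mlast_lemc // mlead_supp.
exists (mleadc P), (mlead P); rewrite mleadc_eq0; split=> //.
apply/mpolyP=> k; rewrite mcoeffZ mcoeffX.
have [<-|ne] := eqVneq; first by rewrite mulr1.
rewrite mulr0; apply: memN_msupp_eq0; apply: contra ne => kP.
by apply/eqP/le_anti; rewrite msupp_le_mlead // Pl mlast_lemc.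
Qed.

Lemma mdvd_mpolyXX (c : K) m1 m2 P :
  c != 0 -> 'X_[m2] = c *: 'X_[m1] * P -> (m1 <= m2)%MM.
Proof.
move=> nzc E; have : c *: 'X_[m1] * P != 0 by rewrite -E -msupp_eq0 msuppX.
rewrite mulf_eq0 negb_or => /andP[nzX nzP].
have := congr1 (@mlead _ _) E.
by rewrite mleadM // mleadXm mleadZ // mleadXm => ->; apply: lem_addr.
Qed.

Variables (J : finType) (M : J -> 'X_{1..n}) (B : {set J}).

Lemma mgcd_dvd j : j \in B ->
  exists Q : {mpoly K[n]}, 'X_[M j] = 'X_[mgcd M B] * Q.
Proof.
by move=> jB; exists 'X_[M j - mgcd M B]; rewrite -mpolyXD addmC submK ?mgcd_le.
Qed.

Lemma dvd_mgcd P : B != set0 -> (forall j, j \in B -> exists Q, 'X_[M j] = P * Q) ->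
  exists Q, 'X_[mgcd M B] = P * Q.
Proof.
move=> B0 dvdP; have /set0Pn[j0 j0B] := B0.
have [Q0 /mdvd_mpolyX[c [m [nzc EP]]]] := dvdP j0 j0B.
have le_m : (m <= mgcd M B)%MM.
  apply: le_mgcd => // j /dvdP[Q]; rewrite EP; exact: mdvd_mpolyXX.
exists (c^-1 *: 'X_[mgcd M B - m]).
by rewrite EP -scalerAl -scalerAr scalerA mulfV // scale1r -mpolyXD addmC submK.
Qed.

End MgcdPoly.

Section WaringRank.
Variables (K : fieldType) (n : nat).
Implicit Types F : {mpoly K[n]}.

(* F, homogeneous of degree [(msize F).-1], is a combination of r powers of
   linear forms (the zero form being allowed). *)
Definition waring_sum F (r : nat) : Prop :=
  exists (c : 'I_r -> K) (L : 'I_r -> {mpoly K[n]}),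
    (forall j, L j \is 1.-homog) /\
    F = \sum_(j < r) c j *: L j ^+ (msize F).-1.

(* The value 0 when no decomposition exists is a convention; in characteristic
   zero every form has a decomposition. *)
Definition waring_rank F : nat :=
  if pselect (exists r, `[< waring_sum F r >]) is left exF
  then ex_minn exF else 0%N.

End WaringRank.

(* Main.v *)
(* Both sides count monomials.  The apolar ideal of a monomial M is spanned by
   the monomials that do not divide M, so A has for basis the monomials free of
   X_0 that divide some M_j, and inclusion-exclusion expresses their number through
   the numbers of monomials free of X_0 that divide the gcd's.  For a monomial
   x^a with 1 <= a_0 <= a_i, this last number is the Waring rank: averaging
   over roots of unity gives a decomposition of that length, and in a shorter
   one a combination of those monomials would vanish at all the points with
   x_0 != 0; multiplied by x_0, it would be apolar to x^a, but it contains a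
   divisor of x^a. *)

From HB Require Import structures.
Require Import Defs.
From mathcomp Require Import all_boot all_order all_algebra.
From mathcomp Require Import cyclic separable.
From mathcomp Require cyclotomic.
From mathcomp Require Import boolp reals complex mpoly.

Set Implicit Arguments.
Unset Strict Implicit.
Unset Printing Implicit Defensive.

Import Order.TTheory GRing.Theory Num.Theory.
Local Open Scope ring_scope.

(** * Inclusion-exclusion and the dimension of a quotient *)

(** For each x, the indicator 1 - \prod_i (1 - [x \in A i]) is expanded over the subsets of [I]; the
    empty subset cancels the leading 1. *)
Lemma card_bigcup_alternating (I T : finType) (A : I -> {set T}) :
  #|\bigcup_i A i|%:Z =
  \sum_(B : {set I} | B != set0) (-1) ^+ #|B|.+1 * #|\bigcap_(i in B) A i|%:Z.
Proof.
have cardZ (C : {set T}) : #|C|%:Z = \sum_x (x \in C)%:Z.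
  rewrite -sum1_card big_mkcond (big_morph Posz PoszD (erefl _)) /=.
  by apply: eq_bigr => x _; case: ifP.
rewrite cardZ; under [RHS]eq_bigr do rewrite cardZ mulr_sumr.
rewrite exchange_big; apply: eq_bigr => x _ /=.
have -> : (x \in \bigcup_i A i)%:Z = 1 - \prod_i (1 - (x \in A i)%:Z).
  have [/bigcupP[i _ xAi]|xA] := boolP (x \in _).
    by rewrite (bigD1 i) //= xAi subrr mul0r subr0.
  rewrite big1 ?subrr // => i _; have /negPf -> : x \notin A i.
    by apply: contra xA => xAi; apply/bigcupP; exists i.
  by rewrite subr0.
under [X in 1 - X]eq_bigr do rewrite addrC.
rewrite bigA_distr (bigD1 set0) ?inE //= [X in 1 - (X + _)]big1 => [|i _];
  last by rewrite inE.
rewrite opprD addrA subrr add0r -sumrN; apply: eq_bigr => B _.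
rewrite exprS mulN1r mulNr; congr (- _).
rewrite -big_mkcond prodrN; congr (_ * _).
have [/bigcapP xB|xB] := boolP (x \in _).
  by rewrite big1 // => i /xB ->.
have [i iB xAi] : exists2 i, i \in B & x \notin A i.
  apply/exists_inP; apply: contraR xB; rewrite negb_exists_in => /forall_inP xB.
  by apply/bigcapP => i /xB; rewrite negbK.
by rewrite (bigD1 i) //= (negPf xAi) mul0r.
Qed.

(** First isomorphism theorem: [phi] is onto, with section [psi], and has kernel [I]. *)
Lemma has_dim_quot_mod (K : nzRingType) (V : lmodType K) (I : submodClosed V)
    (d : nat) (phi : {linear V -> 'rV[K]_d}) (psi : 'rV[K]_d -> V) :
  cancel psi phi -> (forall v, (v \in I) = (phi v == 0)) ->
  has_dim (quot_mod I) d.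
Proof.
move=> psiK phi0.
pose pi v : quot_mod I := (\pi_(Quotient.quot (submod_pred I)) v)%qT.
have repr_pi v : phi (repr (pi v)) = phi v.
  apply/eqP; rewrite -subr_eq0 -raddfB -phi0 -[_ \in I]/(_ \in submod_pred I).
  by rewrite Quotient.idealrBE reprK.
constructor; exists (fun u => phi (repr u)).
  move=> a u v; have [x ->] := quot_modP u; have [y ->] := quot_modP v.
  rewrite -[a *: _]/(quot_scale _ _) quot_scale_pi quot_modD.
  by rewrite !repr_pi linearP.
exists (fun x => pi (psi x)) => [u|x]; last by rewrite repr_pi.
rewrite -[RHS]reprK; apply/eqP; rewrite -Quotient.idealrBE.
by rewrite -[_ \in _]/(_ \in I) phi0 raddfB /= psiK subrr.
Qed.

(** * Roots of unity and their power sums *)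

Lemma prim_root_exists (K : numClosedFieldType) (n : nat) :
  (0 < n)%N -> exists z : K, n.-primitive_root z.
Proof.
move=> n_gt0; pose p : {poly K} := 'X^n - 1.
have [r Dp] := closed_field_poly_normal p.
rewrite (monicP _) ?monicXnsubC // scale1r in Dp.
have rn1 : all n.-unity_root r by apply/allP=> z; rewrite -root_prod_XsubC -Dp.
have sz_r : (n < (size r).+1)%N.
  by rewrite -(size_prod_XsubC r id) -Dp size_XnsubC.
have [|z] := hasP (has_prim_root n_gt0 rn1 _ sz_r); last by exists z.
rewrite -separable_prod_XsubC -Dp cyclotomic.separable_Xn_sub_1 //.
by rewrite pnatr_eq0 -lt0n.
Qed.

Lemma sum_prim_root_exp (K : fieldType) (m : nat) (z : K) (k : nat) :
  m.-primitive_root z ->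
  \sum_(t < m) z ^+ (t * k) = if (m %| k)%N then m%:R else 0.
Proof.
move=> prz; have -> : \sum_(t < m) z ^+ (t * k) = \sum_(t < m) (z ^+ k) ^+ t.
  by apply: eq_bigr => t _; rewrite -exprM mulnC.
rewrite (prim_order_dvd prz).
have [->|zk1] := eqVneq.
  by rewrite (eq_bigr (fun=> 1)) ?sumr_const ?card_ord // => t _; apply: expr1n.
apply: (mulfI (x := z ^+ k - 1)); first by rewrite subr_eq0.
by rewrite -subrX1 mulr0 -exprM mulnC exprM (prim_expr_order prz) expr1n subrr.
Qed.

(** * Coefficients of powers of linear forms *)

Section PowersOfLinearForms.
Variable n : nat.
Implicit Types m k : 'X_{1..n}.

Lemma mmap1M (R : comNzRingType) (h : 'I_n -> R) m1 m2 :
  mmap1 h (m1 + m2) = mmap1 h m1 * mmap1 h m2.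
Proof. by apply: commr_mmap1_M => i x; apply: mulrC. Qed.

Definition mfact m : nat := \prod_i (m i)`!.

Lemma mfact_gt0 m : (0 < mfact m)%N.
Proof. by apply: prodn_gt0 => i; apply: fact_gt0. Qed.

Lemma mfactDU m i : mfact (m + U_(i)) = ((m i).+1 * mfact m)%N.
Proof.
rewrite /mfact (bigD1 i) //= [in RHS](bigD1 i) //= mnmDE mnm1E eqxx addn1 factS.
rewrite -mulnA; congr (_ * (_ * _))%N; apply: eq_bigr => j ji.
by rewrite mnmDE mnm1E eq_sym (negPf ji) addn0.
Qed.

Lemma mderiv_linear_form (R : comNzRingType) (L : {mpoly R[n]}) i :
  L \is 1.-homog -> L^`M(i) = (L@_U_(i))%:MP.
Proof.
move=> Lh; apply/mpolyP => m; rewrite mcoeff_mderiv mcoeffC.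
have [->|m0] := eqVneq; first by rewrite add0m mnm0E mulr1.
rewrite mulr0 (dhomog_nemf_coeff Lh) ?mul0rn //.
by rewrite /= mdegD mdeg1 addn1 eqSS mdeg_eq0.
Qed.

Lemma mderiv_exp (R : comNzRingType) (p : {mpoly R[n]}) i d :
  (p ^+ d.+1)^`M(i) = (p^`M(i) * p ^+ d) *+ d.+1.
Proof.
elim: d => [|d IH]; first by rewrite expr1 expr0 mulr1.
by rewrite exprS mderivM IH mulrnAr mulrCA -exprS -mulrS.
Qed.

(** The multinomial theorem with m! cleared, by induction on d through the i-th derivative of
    L^(d+1), which is (d+1) L_i L^d. *)
Lemma mcoeff_linear_formX (R : comNzRingType) (L : {mpoly R[n]}) d m :
  L \is 1.-homog -> mdeg m = d ->
  (mfact m)%:R * (L ^+ d)@_m = d`!%:R * mmap1 (fun i => L@_U_(i)) m.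
Proof.
move=> Lh; elim: d m => [|d IH] m dm.
  move/eqP: dm; rewrite mdeg_eq0 => /eqP ->.
  by rewrite mmap11 expr0 mcoeff1 eqxx /mfact big1 // => i _; rewrite mnm0E.
have [i mi] : exists i, m i != 0%N.
  apply/existsP; apply: contra_eqT dm; rewrite negb_exists => /forallP m0.
  by rewrite mdegE big1 // => i _; apply/eqP; have := m0 i; rewrite negbK.
have {mi} Um : (U_(i) <= m)%MM.
  by apply/mnm_lepP => j; rewrite mnm1E; case: eqVneq => // <-; rewrite lt0n.
rewrite -(submK Um) in dm *; move: (m - U_(i))%MM dm => {Um}m.
rewrite mdegD mdeg1 addn1 => -[dm].
rewrite mfactDU mmap1M mmap1U mulnC natrM -mulrA (mulr_natl _ (m i).+1).
rewrite -mcoeff_mderiv.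
rewrite mderiv_exp mderiv_linear_form // mcoeffMn mcoeffCM mulrnAr mulrCA IH //.
by rewrite factS natrM -mulrA (mulr_natl _ d.+1) mulrC -mulrA.
Qed.

End PowersOfLinearForms.

(** * Waring rank of monomials *)

Definition ffun_mnm (n k : nat) (f : {ffun 'I_n -> 'I_k.+1}) : 'X_{1..n} :=
  [multinom f i : nat | i < n].

(* The monomials dividing x^a and free of x_0, once k bounds the exponents of a;
   the bound k makes them a finite type common to all the monomials at hand. *)
Definition slice (n k : nat) (a : 'X_{1..n.+1}) :
    {set {ffun 'I_n.+1 -> 'I_k.+1}} :=
  [set f : {ffun 'I_n.+1 -> 'I_k.+1} |
    (f ord0 == 0%N :> nat) && (ffun_mnm f <= a)%MM].

Lemma ffun_mnm_inj (n k : nat) : injective (@ffun_mnm n k).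
Proof.
move=> f g /mnmP fg; apply/ffunP => i; apply: val_inj.
by have := fg i; rewrite !mnmE.
Qed.

Lemma ffun_mnm_surj (n k : nat) (m : 'X_{1..n}) :
  (forall i, m i <= k)%N -> exists f : {ffun 'I_n -> 'I_k.+1}, ffun_mnm f = m.
Proof.
move=> mk; exists [ffun i => inord (m i)].
by apply/mnmP => i; rewrite mnmE ffunE inordK // ltnS.
Qed.

(** This turns the intersections of inclusion-exclusion into sets that Waring ranks will count. *)
Lemma bigcap_slice (n k : nat) (J : finType) (M : J -> 'X_{1..n.+1})
    (B : {set J}) :
  B != set0 -> \bigcap_(j in B) slice k (M j) = slice k (mgcd M B).
Proof.
move=> B0; apply/setP => f; rewrite [RHS]inE; apply/bigcapP/andP => [fB|].
  have [j0 j0B] := set0Pn _ B0.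
  split; first by have := fB _ j0B; rewrite inE => /andP[].
  by apply: le_mgcd => // j /fB; rewrite inE => /andP[].
move=> [f0 fM] j jB; rewrite inE f0; exact: lepm_trans fM (mgcd_le M jB).
Qed.

Section RankOfMonomials.
Variable n : nat.
Implicit Types a m : 'X_{1..n.+1}.

(** The factor p_0^e is common to all monomials homogenized in degree e, so a linear relation
    between their values at p / p_0 persists at p. *)
Lemma mmap1_homogenize (K : fieldType) (p : 'I_n.+1 -> K) m e :
  p ord0 != 0 -> (mdeg m <= e)%N ->
  mmap1 p (m + U_(ord0) *+ (e - mdeg m)) =
    p ord0 ^+ e * mmap1 (fun i => p i / p ord0) m.
Proof.
move=> p0 me; rewrite mmap1M.
have -> : mmap1 p (U_(ord0) *+ (e - mdeg m)) = p ord0 ^+ (e - mdeg m).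
  rewrite /mmap1 (bigD1 ord0) //= mulmnE mnm1E eqxx mul1n.
  rewrite big1 ?mulr1 // => i i0.
  by rewrite mulmnE mnm1E eq_sym (negPf i0) mul0n.
rewrite -{2}(subnK me) exprD -mulrA mulrC; congr (_ * _).
rewrite mdegE -prodrXr /mmap1 -big_split; apply: eq_bigr => i _ /=.
by rewrite -exprMn mulrC divfK.
Qed.

(* Comparing coefficients, a decomposition of x^a is a weighted family of points
   p_j whose power sums of order mdeg a all vanish, but the a-th one. *)
Lemma waring_sum_power_sums (K : numFieldType) a r :
  waring_sum ('X_[a] : {mpoly K[n.+1]}) r ->
  exists (c : 'I_r -> K) (p : 'I_r -> 'I_n.+1 -> K),
    forall m, mdeg m = mdeg a ->
      (\sum_j c j * mmap1 (p j) m == 0) = (m != a).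
Proof.
move=> [c [L [Lh]]]; rewrite msizeX /= => eqa.
exists c, (fun j i => (L j)@_U_(i)) => m dm.
have f0 d : d`!%:R != 0 :> K by rewrite pnatr_eq0 -lt0n fact_gt0.
have mf0 : (mfact m)%:R != 0 :> K by rewrite pnatr_eq0 -lt0n mfact_gt0.
(* In characteristic zero the factorials cancel, which leaves the coefficient of x^m. *)
rewrite -(mulrI_eq0 _ (mulfI (f0 (mdeg a)))) mulr_sumr.
rewrite (eq_bigr (fun j => (mfact m)%:R * (c j * (L j ^+ mdeg a)@_m)));
  last by move=> j _; rewrite mulrCA -mcoeff_linear_formX // mulrCA.
rewrite -mulr_sumr (mulrI_eq0 _ (mulfI mf0)).
have -> : \sum_j c j * (L j ^+ mdeg a)@_m = ('X_[a] : {mpoly K[n.+1]})@_m.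
  by rewrite eqa raddf_sum; apply: eq_bigr => j _; rewrite /= mcoeffZ.
by rewrite mcoeffX pnatr_eq0 eqb0 eq_sym.
Qed.

Lemma waring_sum_monomial_ge (K : numFieldType) (k : nat) a r :
  (0 < a ord0)%N -> waring_sum ('X_[a] : {mpoly K[n.+1]}) r ->
  (#|slice k a| <= r)%N.
Proof.
(* With fewer than #|slice k a| points, some combination g of the monomials of
   slice k a vanishes at the points with p_0 != 0.  If b s has maximal degree e
   in g, then x^m0 * x_0 * (g homogenized in degree e) vanishes at every point,
   while a occurs among its exponents, at t = s only. *)
move=> a0 /waring_sum_power_sums[c [p cp]]; rewrite leqNgt; apply/negP => ltr.
pose b (s : 'I_#|slice k a|) := ffun_mnm (enum_val s).
have bP s : b s ord0 = 0%N /\ (b s <= a)%MM.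
  by have := enum_valP s; rewrite inE mnmE => /andP[/eqP ? ?].
(* Points with p_0 = 0 get a zero column: they impose no condition on [v]. *)
pose A := \matrix_(s, j) if p j ord0 == 0 then 0
                         else mmap1 (fun i => p j i / p j ord0) (b s).
have [v v0 vA] : exists2 v : 'rV_#|slice k a|, v != 0 & v *m A = 0.
  exists (nz_row (kermx A)); last by apply/sub_kermxP/nz_row_sub.
  rewrite nz_row_eq0 kermx_eq0 /row_free neq_ltn.
  by rewrite (leq_ltn_trans (rank_leq_col A)).
have [s0 vs0] : exists s, v 0 s != 0 by apply/rV0Pn.
have [s vs max_s] := @arg_maxnP _ s0 (fun s => v 0 s != 0) (mdeg \o b) vs0.
have [bs0 bsa] := bP s; pose e := mdeg (b s).
have le_e t : v 0 t != 0 -> (mdeg (b t) <= e)%N by apply: max_s.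
pose m0 := (a - (b s + U_(ord0)))%MM.
have m0K : (m0 + (b s + U_(ord0)))%MM = a.
  apply: submK; apply/mnm_lepP => i; rewrite mnmDE mnm1E.
  case: eqVneq => [<-|_]; first by rewrite bs0.
  by rewrite addn0; apply/mnm_lepP.
(* The 1 in [e.+1] leaves a factor x_0 in each [test t] with [v 0 t] nonzero, which settles the
   points with p_0 = 0. *)
pose test t := (m0 + (b t + U_(ord0) *+ (e.+1 - mdeg (b t))))%MM.
have test_deg t : v 0 t != 0 -> mdeg (test t) = mdeg a.
  move=> /le_e le_te; rewrite -m0K /test !mdegD mdegMn !mdeg1 mul1n.
  by rewrite subnKC ?addn1 //; apply: leqW.
have test_a t : (test t == a) = (t == s).
  apply/eqP/eqP => [|->]; last by rewrite /test subSnn mulm1n m0K.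
  move=> Et; apply/enum_val_inj/ffun_mnm_inj/mnmP => i.
  have [->|i0] := eqVneq i ord0.
    by rewrite -/(b t) -/(b s) bs0; case: (bP t).
  move: Et; rewrite -[in RHS]m0K /test => /addmI/mnmP/(_ i).
  by rewrite !mnmDE mulmnE mnm1E eq_sym (negPf i0) mul0n !addn0.
(* This double sum is evaluated in two ways: summed over j first, only t = s survives; summed over t
   first, every point contributes zero. *)
have : \sum_t v 0 t * \sum_j c j * mmap1 (p j) (test t) != 0.
  rewrite (bigD1 s) //= [X in _ + X]big1 ?addr0 => [|t ts].
    by rewrite mulf_neq0 // cp ?test_deg // test_a eqxx.
  have [->|vt] := eqVneq (v 0 t) 0; first by rewrite mul0r.
  by apply/eqP; rewrite mulf_eq0 cp ?test_deg // test_a ts orbT.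
case/eqP; under eq_bigr do rewrite mulr_sumr.
rewrite exchange_big big1 // => j _ /=.
have [p0|p0] := eqVneq (p j ord0) 0.
  rewrite big1 // => t _.
  have [->|vt] := eqVneq (v 0 t) 0; first by rewrite mul0r.
  rewrite /mmap1 (bigD1 ord0) //= p0 expr0n.
  rewrite /test !mnmDE mulmnE mnm1E eqxx mul1n.
  by rewrite !addn_eq0 subn_eq0 leqNgt ltnS le_e // !andbF !mul0r !mulr0.
have /rowP/(_ j) := vA; rewrite !mxE => vAj.
rewrite (eq_bigr (fun t =>
  c j * mmap1 (p j) m0 * p j ord0 ^+ e.+1 * (v 0 t * A t j))).
  by rewrite -mulr_sumr vAj mulr0.
move=> t _; have [->|vt] := eqVneq (v 0 t) 0; first by rewrite !mul0r mulr0.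
rewrite /test mmap1M mmap1_homogenize //; last exact/leqW/le_e.
rewrite mxE (negPf p0) mulrCA -!mulrA; congr (_ * _).
by rewrite mulrCA; congr (_ * _); apply: mulrCA.
Qed.

Lemma waring_sum_monomial (K : numClosedFieldType) (k : nat) a :
  (forall i, a ord0 <= a i)%N -> (forall i, a i <= k)%N ->
  waring_sum ('X_[a] : {mpoly K[n.+1]}) #|slice k a|.
Proof.
(* The linear forms are x_0 + z_1 x_1 + ... + z_n x_n, where each z_i ranges
   over the (a_i + 1)-th roots of unity, with weight z_1 ... z_n: a monomial x^m
   survives iff a_i + 1 divides m_i + 1 for all i > 0, and, in degree mdeg a,
   this forces m = a because a_0 <= a_i. *)
move=> a0 ak; pose e i := if i == ord0 :> 'I_n.+1 then 0%N else a i.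
have [z prz] : exists z : 'I_n.+1 -> K,
    forall i, (e i).+1.-primitive_root (z i).
  apply: (fin_all_exists (P := fun i x => (e i).+1.-primitive_root x)) => i.
  exact: prim_root_exists.
have f0 d : d`!%:R != 0 :> K by rewrite pnatr_eq0 -lt0n fact_gt0.
(* [C] normalizes the coefficient of x^a to 1: the sums over roots of unity contribute \prod_i (e_i
   + 1). *)
have [C EC] : exists C : K,
    C * (mdeg a)`!%:R * \prod_i (e i).+1%:R = (mfact a)%:R.
  exists ((mfact a)%:R / ((mdeg a)`!%:R * \prod_i (e i).+1%:R)).
  rewrite -mulrA divfK // mulf_neq0 //.
  by apply/prodf_neq0 => i _; rewrite pnatr_eq0.
pose L (f : {ffun 'I_n.+1 -> 'I_k.+1}) : {mpoly K[n.+1]} :=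
  \sum_i z i ^+ f i *: 'X_i.
have Lh f : L f \is 1.-homog.
  by apply: rpred_sum => i _; apply: rpredZ; rewrite dhomogX /= mdeg1.
have LU f i : (L f)@_U_(i) = z i ^+ f i.
  rewrite raddf_sum /= (bigD1 i) //= mcoeffZ mcoeffXU eqxx mulr1.
  by rewrite big1 ?addr0 // => j ji; rewrite mcoeffZ mcoeffXU (negPf ji) mulr0.
pose c (f : {ffun 'I_n.+1 -> 'I_k.+1}) := C * \prod_i z i ^+ f i.
exists (fun s => c (enum_val s)), (fun s => L (enum_val s)).
split=> [//|]; rewrite msizeX /=.
rewrite -(big_enum_val (fun f => c f *: L f ^+ mdeg a)) /=.
apply/mpolyP => m; rewrite mcoeffX raddf_sum /=.
under [RHS]eq_bigr do rewrite mcoeffZ.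
have [dm|dm] := eqVneq (mdeg m) (mdeg a); last first.
  have /negPf -> : a != m by apply: contraNneq dm => ->.
  rewrite big1 // => f _.
  by rewrite (dhomog_nemf_coeff (dhomogMn _ (Lh f))) ?mulr0 //= mul1n.
have mf0 (b : 'X_{1..n.+1}) : (mfact b)%:R != 0 :> K.
  by rewrite pnatr_eq0 -lt0n mfact_gt0.
apply: (mulfI (mf0 m)); rewrite mulr_sumr.
rewrite (eq_bigr (fun f : {ffun 'I_n.+1 -> 'I_k.+1} =>
   C * (mdeg a)`!%:R * \prod_i z i ^+ (f i * (m i).+1))); last first.
  move=> f _; rewrite mulrCA /c mcoeff_linear_formX // -!mulrA; congr (_ * _).
  rewrite mulrCA; congr (_ * _); rewrite /mmap1 -big_split.
  apply: eq_bigr => i _ /=.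
  by rewrite LU -exprM -exprD mulnS.
rewrite -mulr_sumr.
rewrite (eq_bigl (mem
  (family (fun i => [pred t : 'I_k.+1 | t < (e i).+1]%N)))); last first.
  move=> f; rewrite inE; apply/andP/familyP => [[/eqP f00 /mnm_lepP fa] i|fe].
    rewrite inE ltnS /e; case: eqVneq => [->|_]; first by rewrite f00.
    by have := fa i; rewrite mnmE.
  split; first by have := fe ord0; rewrite inE /e eqxx ltnS leqn0.
  apply/mnm_lepP => i; have := fe i; rewrite inE ltnS mnmE /e.
  by case: eqVneq => // _; rewrite leqn0 => /eqP ->.
(* A sum over a box factors into one sum over roots of unity per variable. *)
rewrite -(bigA_distr_big_dep _ (fun i (t : 'I_k.+1) => z i ^+ (t * (m i).+1))).
have ek i : ((e i).+1 <= k.+1)%N by rewrite ltnS /e; case: eqP.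
under [X in _ = _ * X]eq_bigr => i _ do
  rewrite -(big_ord_widen _ (fun t : nat => z i ^+ (t * (m i).+1)) (ek i))
          (sum_prim_root_exp _ (prz i)).
have [eqam|neqam] := eqVneq a m.
  rewrite mulr1 -eqam (eq_bigr (fun i => (e i).+1%:R)) => [//|i _].
  by rewrite /e; case: eqP => [_|_]; rewrite ?dvd1n ?dvdnn.
have [i ndvd] : exists i, ~~ ((e i).+1 %| (m i).+1)%N.
  apply/existsP; rewrite -negb_forall; apply: contra neqam => /forallP dvd.
  have le_am i : i != ord0 -> (a i <= m i)%N.
    by move=> i0; have := dvdn_leq (ltn0Sn _) (dvd i); rewrite /e (negPf i0).
  (* If a_i < m_i, then m_i + 1 >= 2 (a_i + 1), so m_i > a_i + a_0 and the degree of m is too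
     large. *)
  have eq_am i : i != ord0 -> a i = m i.
    move=> i0; apply/eqP; rewrite eqn_leq le_am //= leqNgt; apply/negP => lt_am.
    have : (a i + a i < m i)%N.
      have := dvd i; rewrite /e (negPf i0) => /dvdnP[[//|[|q]] Eq].
        by move: lt_am; rewrite -ltnS Eq mul1n ltnn.
      by rewrite -ltnS Eq !mulSn !addSn addnS !ltnS addnA leq_addr.
    move: dm; rewrite !mdegE (bigD1 ord0) //= (bigD1 i) //=.
    rewrite [in RHS](bigD1 ord0) //= [in RHS](bigD1 i) //= => dm lt_aam.
    have : (\sum_(j < n.+1 | (j != ord0) && (j != i)) a j <=
            \sum_(j < n.+1 | (j != ord0) && (j != i)) m j)%N.
      by apply: leq_sum => j /andP[/le_am].
    apply/negP; rewrite -ltnNge -(ltn_add2l (m ord0 + m i)) -addnA dm addnA.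
    rewrite ltn_add2r.
    rewrite (leq_trans _ (leq_addl _ _)) // (leq_ltn_trans _ lt_aam) //.
    by rewrite leq_add2r.
  apply/eqP/mnmP => i; have [->|/eq_am//] := eqVneq i ord0.
  move: dm; rewrite !mdegE (bigD1 ord0) //= [in RHS](bigD1 ord0) //=.
  rewrite (eq_bigr a) => [/eqP|j /eq_am //].
  by rewrite eqn_add2r => /eqP.
by rewrite mulr0 (bigD1 i) //= (negPf ndvd) mul0r mulr0.
Qed.

Lemma waring_rank_monomial (K : numClosedFieldType) (k : nat) a :
  (forall i, 0 < a ord0 <= a i)%N -> (forall i, a i <= k)%N ->
  waring_rank ('X_[a] : {mpoly K[n.+1]}) = #|slice k a|.
Proof.
move=> a0 ak; have a_ge i : (a ord0 <= a i)%N by case/andP: (a0 i).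
have wa := waring_sum_monomial K a_ge ak.
rewrite /waring_rank; case: pselect => [exF|[]]; last first.
  by exists #|slice k a|; apply/asboolP.
case: ex_minnP => r /asboolP wr min_r; apply/eqP; rewrite eqn_leq.
rewrite min_r; last exact/asboolP.
by apply: waring_sum_monomial_ge wr; case/andP: (a0 ord0).
Qed.

End RankOfMonomials.

(** * The ideal (X_0) + \bigcap_j M_j^\perp *)

Section MonomialIdeal.
Variables (K : numFieldType) (n : nat) (J : finType) (M : J -> 'X_{1..n.+1}).

(** Multiples of X_0 do not reach m. In Q(x^(M_j)) = 0, the coefficient of x^(M_j - m) is a nonzero
    multiple of that of X^m in Q. *)
Lemma X0_plus_apolar_mcoeff (G : {mpoly K[n.+1]}) j (m : 'X_{1..n.+1}) :
  G \in X0_plus_apolar M -> m ord0 = 0%N -> (m <= M j)%MM -> G@_m = 0.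
Proof.
move=> /asboolP[P [Q [-> /(_ j) apQ]]] m0 mM; rewrite mcoeffD.
have -> : ('X_ord0 * P)@_m = 0.
  apply: memN_msupp_eq0; apply/negP => /msuppM_le/allpairsP[[u v] /= [+ _ mE]].
  rewrite msuppX mem_seq1 => /eqP uE; move: m0.
  by rewrite mE uE mnmDE mnm1E eqxx.
rewrite add0r; move: apQ; rewrite unfold_in => /eqP/(congr1 (mcoeff (M j - m))).
rewrite mcoeff0 /diff_act raddf_sum /=.
have subK v : (v <= M j)%MM -> (M j - (M j - v))%MM = v.
  by move=> vM; rewrite submBA // addmC addmK.
have coefE u : (Q@_u *: ('X_[M j])^`M[u])@_(M j - m) =
    if u == m then Q@_m * (\prod_(i < n.+1) (M j i)^_(m i))%:R else 0.
  rewrite mcoeffZ mderivmX mcoeffZ mcoeffX; have [->|um] := eqVneq u m.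
    by rewrite eqxx mulr1.
  (* Subtraction is truncated, so a u not dividing [M j] could collide with m; its derivative
     vanishes, by a zero falling factorial. *)
  have [uM|uM] := boolP (u <= M j)%MM; last first.
    have [i ui] : exists i, ~~ (u i <= M j i)%N.
      by apply/existsP; rewrite -negb_forall.
    by rewrite (bigD1 i) //= ffact_small ?ltnNge // mul0n mul0r mulr0.
  rewrite (_ : (_ == _) = false) ?mulr0 //; apply: contra_neqF um => /eqP um.
  by rewrite -(subK _ uM) um subK.
under eq_bigr do rewrite coefE.
have [mQ|mQ] := boolP (m \in msupp Q); last first.
  by rewrite (memN_msupp_eq0 mQ).
rewrite (bigD1_seq m) ?msupp_uniq //= eqxx [X in _ + X]big1;
  last by move=> u /negPf ->.
rewrite addr0 => /eqP.
rewrite mulf_eq0 pnatr_eq0 (negPf (lt0n_neq0 _)) ?orbF => [/eqP//|].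
by apply: prodn_gt0 => i; rewrite ffact_gt0; apply/mnm_lepP.
Qed.

(** Such a monomial is a multiple of X_0 or annihilates every x^(M_j). *)
Lemma X0_plus_apolarX (m : 'X_{1..n.+1}) :
  ~~ ((m ord0 == 0%N) && [exists j, (m <= M j)%MM]) ->
  ('X_[m] : {mpoly K[n.+1]}) \in X0_plus_apolar M.
Proof.
rewrite negb_and => /orP[m0|/existsPn mM]; apply/asboolP.
  exists 'X_[m - U_(ord0)], 0; split=> [|j]; last exact: apolar0.
  rewrite addr0 -mpolyXD addmC submK //; apply/mnm_lepP => i.
  by rewrite mnm1E; case: eqVneq => // <-; rewrite lt0n.
exists 0, 'X_[m]; rewrite mulr0 add0r; split=> // j.
rewrite unfold_in diff_actX mderivmX.
have [i mi] : exists i, ~~ (m i <= M j i)%N.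
  by apply/existsP; rewrite -negb_forall; apply: mM.
by rewrite (bigD1 i) //= ffact_small ?ltnNge // mul0n scale0r.
Qed.

(** The coefficients at the monomials of the union of slices serve as coordinates on the
    quotient. *)
Lemma has_dim_X0_plus_apolar (k : nat) :
  (forall j i, M j i <= k)%N ->
  has_dim (quot_mod (@X0_plus_apolar K n J M)) #|\bigcup_j slice k (M j)|.
Proof.
move=> Mk; set S := \bigcup_j _.
pose b (s : 'I_#|S|) := ffun_mnm (enum_val s).
have b_inj : injective b by move=> s t /ffun_mnm_inj/enum_val_inj.
pose phi (G : {mpoly K[n.+1]}) := \row_s G@_(b s).
have phi_lin : linear phi.
  by move=> c G H; apply/rowP => s; rewrite !mxE mcoeffD mcoeffZ.
pose lphi :=
  GRing.isLinear.Build K {mpoly K[n.+1]} 'rV[K]_#|S| *:%R phi phi_lin.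
pose philin : {linear {mpoly K[n.+1]} -> 'rV[K]_#|S|} := HB.pack phi lphi.
apply: (@has_dim_quot_mod _ _ _ _ philin (fun x => \sum_s x 0 s *: 'X_[b s])).
  move=> x; apply/rowP => s; rewrite mxE raddf_sum (bigD1 s) //=.
  rewrite big1 => [|t ts]; first by rewrite mcoeffZ mcoeffX eqxx mulr1 addr0.
  by rewrite mcoeffZ mcoeffX (inj_eq b_inj) (negPf ts) mulr0.
move=> G; apply/idP/eqP => [GI|/rowP G0].
  apply/rowP => s; rewrite !mxE.
  have /bigcupP[j _] := enum_valP s; rewrite inE => /andP[/eqP s0].
  by apply: X0_plus_apolar_mcoeff => //; rewrite mnmE.
rewrite (mpolyE G) big_seq; apply: rpred_sum => m mG; apply: rpredZ.
apply: X0_plus_apolarX; apply: contraL mG => /andP[/eqP m0 /existsP[j mM]].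
rewrite -mcoeff_eq0; have [|f fm] := @ffun_mnm_surj _ k m.
  by move=> i; apply: leq_trans (Mk j i); apply/mnm_lepP.
have fS : f \in S.
  apply/bigcupP; exists j => //; rewrite inE fm mM andbT.
  by rewrite -m0 -fm mnmE.
by have := G0 (enum_rank_in fS f); rewrite !mxE /b enum_rankK_in // fm => ->.
Qed.

End MonomialIdeal.

Theorem proposition2p3 (R : realType) (n : nat) (J : finType)
    (M : J -> 'X_{1..n.+1}) (J_neq0 : (0 < #|J|)%N)
    (M_exp : forall (i : 'I_n.+1) (j : J), (1 <= M j ord0 <= M j i)%N) :
  exists d : nat,
    has_dim (quot_mod (@X0_plus_apolar R[i] n J M)) d /\
    d%:Z = \sum_(B : {set J} | B != set0)
      (-1) ^+ #|B|.+1 * (waring_rank ('X_[mgcd M B] : {mpoly R[i][n.+1]}))%:Z.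
Proof.
pose k := (\max_j \max_i M j i)%N.
have Mk j i : (M j i <= k)%N.
  apply: leq_trans (leq_bigmax (F := fun j => (\max_i M j i)%N) j).
  exact: leq_bigmax.
exists #|\bigcup_j slice k (M j)|; split; first exact: has_dim_X0_plus_apolar.
rewrite card_bigcup_alternating; apply: eq_bigr => B B0; congr (_ * Posz _).
rewrite bigcap_slice // (@waring_rank_monomial _ _ k) //.
  move=> i; apply/andP; split.
    (* The gcd inherits the bounds on exponents since x_0, then x_i raised to the exponent of x_0 in
       the gcd, are common divisors. *)
    have : (U_(ord0) <= mgcd M B)%MM.
      apply: le_mgcd => // j _; apply/mnm_lepP => h; rewrite mnm1E.
      by case: eqVneq => // <-; case/andP: (M_exp ord0 j).
    by move/mnm_lepP/(_ ord0); rewrite mnm1E eqxx.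
  have : (U_(i) *+ mgcd M B ord0 <= mgcd M B)%MM.
    apply: le_mgcd => // j jB; apply/mnm_lepP => h; rewrite mulmnE mnm1E.
    case: eqVneq => [<-|]; rewrite ?mul0n // mul1n.
    have /mnm_lepP/(_ ord0) le0 := mgcd_le M jB.
    by apply: leq_trans le0 _; case/andP: (M_exp i j).
  by move/mnm_lepP/(_ i); rewrite mulmnE mnm1E eqxx mul1n.
have [j jB] := set0Pn _ B0 => i.
by apply: leq_trans (Mk j i); apply/mnm_lepP/mgcd_le.
Qed.
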